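(* Let $R$ be a ring with identity and $M$ a right $R$-module such that $R - Zd(M)$ is contained in the center of $R$. If $M$ is a regular fusible module, then $M$ is nonsingular.
   Context: Rings are associative with identity, not necessarily commutative; modules are unital right modules. For $m\in M$, $ann_R(m)=\{r\in R: mr=0\}$, a right ideal of $R$. $T_R(M)=\{m\in M: mr=0\text{ for some } 0\neq r\in R\}=\{m\in M: ann_R(m)\neq 0\}$ is the set of torsion elements, and $T_R^{\star}(M)=\{m\in M: ann_R(m)=0\}$ is the set of torsion free elements. $Zd(M)=\{r\in R: mr=0\text{ for some }0\neq m\in M\}$. An element of $M$ is fusible if it can be written as $x+y$ with $x\in T_R(M)$ and $y\in T_R^{\star}(M)$. A nonzero $m\in M$ is regular fusible if there exists $r\in R-Zd(M)$ such that $mr$ is fusible; $M$ is a regular fusible module if every nonzero element of $M$ is regular fusible. A right ideal $I$ of $R$ is essential, written $I\leq_e R$, if $I\cap J\neq 0$ for every nonzero right ideal $J$ of $R$. The singular submodule is $Z(M)=\{m\in M: ann_R(m)\leq_e R\}$, and $M$ is nonsingular if $Z(M)=0$. *)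

(* Defs.v *)
From mathcomp Require Import all_boot all_algebra.
From mathcomp Require Import boolp classical_sets.

Set Implicit Arguments.
Unset Strict Implicit.
Unset Printing Implicit Defensive.

Import GRing.Theory.

Local Open Scope ring_scope.
Local Open Scope classical_set_scope.

(* A right R-module is a left module over the converse ring R^c:
   for M : lmodType R^c, the product m r is r *: m with r seen in R^c. *)
Definition ract (R : pzRingType) (M : lmodType R^c) (m : M) (r : R) : M :=
  (r : R^c) *: m.

Notation "m *' r" := (ract m r) (at level 40, left associativity) : ring_scope.

Lemma ractA (R : pzRingType) (M : lmodType R^c) (m : M) (r s : R) :
  (m *' r) *' s = m *' (r * s).
Proof. by rewrite /ract scalerA. Qed.

Section RightIdeals.
Variable R : pzRingType.
Implicit Types I J : set R.

Definition right_ideal I : Prop :=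
  [/\ I 0, forall x y, I x -> I y -> I (x - y)
    & forall x r, I x -> I (x * r)].

Definition essential I : Prop :=
  right_ideal I /\
  forall J, right_ideal J -> J <> [set 0] -> I `&` J <> [set 0].

Definition center : set R := [set z | forall r, GRing.comm z r].

End RightIdeals.

Arguments center R : clear implicits.

Section RightModules.
Variables (R : pzRingType) (M : lmodType R^c).
Implicit Types m x y : M.

Definition ann m : set R := [set r | m *' r = 0].

Definition torsion : set M := [set m | exists2 r : R, r <> 0 & m *' r = 0].

Definition torsion_free : set M := [set m | ann m = [set 0]].

Definition Zd : set R := [set r | exists2 m : M, m <> 0 & m *' r = 0].

Definition fusible m : Prop :=
  exists x y, [/\ torsion x, torsion_free y & m = x + y].

Definition regular_fusible m : Prop :=
  m <> 0 /\ exists2 r : R, (~` Zd) r & fusible (m *' r).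

Definition regular_fusible_module : Prop :=
  forall m, m <> 0 -> regular_fusible m.

Definition singular_submodule : set M := [set m | essential (ann m)].

Definition nonsingular : Prop := singular_submodule = [set 0].

Lemma right_ideal_ann m : right_ideal (ann m).
Proof.
split=> [|x y|x r]; rewrite /ann /ract /=; first by rewrite (scale0r m).
  by move=> mx my; rewrite (scalerBl (x : R^c) (y : R^c)) mx my subrr.
by move=> mx; rewrite -/(ract m (x * r)) -ractA /ract mx scaler0.
Qed.

End RightModules.

Arguments torsion {R} M.
Arguments torsion_free {R} M.
Arguments Zd {R} M.
Arguments regular_fusible_module {R} M.
Arguments singular_submodule {R} M.
Arguments nonsingular {R} M.

(* Main.v *)
Require Import Defs.
From mathcomp Require Import all_boot all_algebra.
From mathcomp Require Import boolp classical_sets.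

Import GRing.Theory.

(** If [x + y] is killed by [r] and so is [x], then so is [y].  When [x] is
    torsion and [y] torsion free, this says that the annihilator of [x + y]
    meets the nonzero right ideal [ann x] trivially: a fusible element is never
    singular ([fusible_not_singular]).  On the other hand, acting by a central
    scalar can only enlarge an annihilator, so it preserves singularity
    ([singular_ract_central]).  For a nonzero singular [m], regular fusibility
    yields a scalar [r] outside [Zd M], central by hypothesis, with [m *' r]
    fusible; but [m *' r] is also singular, a contradiction. *)

Local Open Scope ring_scope.
Local Open Scope classical_set_scope.

Lemma ractDl (R : pzRingType) (M : lmodType R^c) (x y : M) (r : R) :
  (x + y) *' r = x *' r + y *' r.
Proof. exact: scalerDr. Qed.

Lemma right_ideal_setI0 (R : pzRingType) (I J : set R) :
  right_ideal I -> right_ideal J ->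
  (forall r, I r -> J r -> r = 0) -> I `&` J = [set 0].
Proof.
move=> [I0 _ _] [J0 _ _] IJ0; apply/seteqP; split=> [r [Ir Jr]|r ->] /=.
  exact: IJ0.
by split.
Qed.

Lemma essentialS (R : pzRingType) (I J : set R) :
  right_ideal J -> I `<=` J -> essential I -> essential J.
Proof.
move=> rJ IJ [rI eI]; split=> // K rK nzK JK0.
apply: (eI K rK nzK); apply: right_ideal_setI0 => // r Ir Kr.
have : (J `&` K) r by split=> //; exact: IJ.
by rewrite JK0.
Qed.

Lemma singular0 (R : pzRingType) (M : lmodType R^c) :
  singular_submodule M 0.
Proof.
split; first exact: right_ideal_ann.
have -> : ann (0 : M) = setT.
  by apply/seteqP; split=> // r _; exact: scaler0.
by move=> J _; rewrite setTI.
Qed.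

(** For an arbitrary scalar [r], the annihilator of [m *' r] need not contain
    that of [m]; centrality is what lets [r] and [s] be exchanged in
    [m *' r *' s]. *)
Lemma singular_ract_central (R : pzRingType) (M : lmodType R^c) (m : M) (r : R) :
  center R r -> singular_submodule M m -> singular_submodule M (m *' r).
Proof.
move=> zr; apply: essentialS; first exact: right_ideal_ann.
by move=> s ms0; rewrite /ann /= ractA (zr s) -ractA ms0; exact: scaler0.
Qed.

(** The torsion summand supplies the nonzero right ideal that witnesses the
    failure of essentiality. *)
Lemma fusible_not_singular (R : pzRingType) (M : lmodType R^c) (m : M) :
  fusible m -> ~ singular_submodule M m.
Proof.
move=> [x [y [[t nzt xt0] yfree ->]]] [_ ess].
apply: (ess (ann x)); first exact: right_ideal_ann.
  by move=> annx0; apply: nzt; have : ann x t := xt0; rewrite annx0.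
apply: right_ideal_setI0; [exact: right_ideal_ann..|move=> r xyr0 xr0].
have : ann y r.
  by move: xyr0; rewrite /ann /= ractDl xr0 add0r.
by rewrite yfree.
Qed.

Theorem proposition3 (R : pzRingType) (M : lmodType R^c)
    (hcentral : ~` Zd M `<=` center R)
    (hfusible : regular_fusible_module M) :
  nonsingular M.
Proof.
apply/seteqP; split=> [m singm|m ->] /=; last exact: singular0.
apply: contrapT => /hfusible[_ [r regr fus]].
apply: fusible_not_singular fus _.
exact: singular_ract_central (hcentral _ regr) singm.
Qed.
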